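(* Let $\mathfrak R$ be a topologically semiperfect topological ring. Then any finitely generated discrete right $\mathfrak R$-module has a projective cover in the category of (all abstract) right $\mathfrak R$-modules.
   Context: All rings are associative and unital. All topological rings are complete, separated and right linear: open right ideals $\mathfrak I$ form a base of neighborhoods of zero and $\mathfrak R\to\varprojlim_{\mathfrak I}\mathfrak R/\mathfrak I$ is bijective. A family $(r_x)_{x\in X}$ in $\mathfrak R$ is zero-convergent if every open right ideal contains $r_x$ for all but finitely many $x$; infinite sums of zero-convergent families are limits of finite partial sums. A nonzero ring is local if its noninvertible elements form an additive subgroup. $\mathfrak R$ is topologically semiperfect if there exist a set $Z$ and a zero-convergent family $(e_z)_{z\in Z}$ of pairwise orthogonal idempotents in $\mathfrak R$ with $\sum_{z\in Z}e_z=1$ such that every ring $e_z\mathfrak R e_z$ is local. A right $\mathfrak R$-module is discrete if the annihilator of each of its elements is an open right ideal in $\mathfrak R$. A projective cover of a module $M$ is a surjective homomorphism $P\to M$ with $P$ projective and with superfluous kernel. *)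

(* Defs.v *)
From HB Require Import structures.
From mathcomp Require Import all_boot all_order all_algebra.
From mathcomp Require Import boolp classical_sets functions cardinality.
From mathcomp Require Import topology normedtype summability.

Set Implicit Arguments.
Unset Strict Implicit.
Unset Printing Implicit Defensive.

Import GRing.Theory.

Local Open Scope classical_set_scope.
Local Open Scope ring_scope.

(* Rings are [pzRingType]s, so that the zero ring is allowed. *)

HB.mixin Record TopologicalZmodule_isTopologicalPzRing R
    & TopologicalZmodule R & GRing.PzRing R := {
  mul_continuous : continuous (fun x : R * R => x.1 * x.2)
}.

#[short(type="topologicalPzRingType")]
HB.structure Definition TopologicalPzRing :=
  {R of TopologicalZmodule R & GRing.PzRing R
        & TopologicalZmodule_isTopologicalPzRing R}.

Definition additive_subgroup (V : zmodType) (A : set V) : Prop :=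
  A 0 /\ forall x y, A x -> A y -> A (x - y).

Definition right_ideal (R : pzRingType) (I : set R) : Prop :=
  additive_subgroup I /\ forall x r, I x -> I (x * r).

Definition coset (V : zmodType) (A : set V) (x : V) : set V :=
  [set y | A (y - x)].

Section TopologicalRings.
Variable R : topologicalPzRingType.

Definition open_right_ideal (I : set R) : Prop := open I /\ right_ideal I.

Definition right_linear_topology : Prop :=
  forall U : set R, nbhs (0 : R) U ->
    exists2 I, open_right_ideal I & I `<=` U.

(* The projective limit of the quotients R/I: an element of R/I is a coset of
   I, and for I contained in J the transition map R/I -> R/J sends a coset of I
   to the unique coset of J which contains it. *)
Definition quotient_limit : set ({I : set R | open_right_ideal I} -> set R) :=
  [set c | (forall I, exists r, c I = coset (sval I) r) /\
           (forall I J, sval I `<=` sval J -> c I `<=` c J)].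

Definition to_quotient_limit (r : R) :
    {I : set R | open_right_ideal I} -> set R :=
  fun I => coset (sval I) r.

Definition complete_separated : Prop :=
  set_bij setT quotient_limit to_quotient_limit.

Definition zero_convergent (X : Type) (r : X -> R) : Prop :=
  forall I, open_right_ideal I -> finite_set [set x | ~ I (r x)].

Definition has_sum (X : choiceType) (r : X -> R) (s : R) : Prop :=
  partial_sum r J @[J --> totally] --> s.

End TopologicalRings.

Definition invertible (A : pzRingType) (x : A) : Prop :=
  exists y, x * y = 1 /\ y * x = 1.

Definition local_ring (A : pzRingType) : Prop :=
  (1 : A) <> 0 /\ additive_subgroup [set x : A | ~ invertible x].

Definition corner_set (R : pzRingType) (e : R) : {pred R} :=
  [pred x | x \in range (fun r => e * r * e)].

(* The ring eRe, with unit e. *)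
Definition corner (R : pzRingType) (e : R) (ee : e * e = e) : Type :=
  {x : R | x \in corner_set e}.

Section CornerRing.
Variables (R : pzRingType) (e : R) (ee : e * e = e).

Local Notation eRe := (corner_set e).
Local Notation C := (corner ee).

Lemma cornerP (x : R) : reflect (e * x * e = x) (x \in eRe).
Proof.
rewrite inE; apply: (iffP idP) => [|exe]; last by apply/mem_set; exists x.
by move=> /set_mem[r _ <-]; rewrite !mulrA ee -!mulrA ee.
Qed.

Lemma corner_zmod_closed : zmod_closed eRe.
Proof.
split=> [|x y /cornerP ex /cornerP ey]; apply/cornerP.
  by rewrite mulr0 mul0r.
by rewrite mulrBr mulrBl ex ey.
Qed.

HB.instance Definition _ := GRing.isZmodClosed.Build R eRe corner_zmod_closed.

HB.instance Definition _ := [isSub of C for @sval R (fun x => x \in eRe)].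
HB.instance Definition _ := [Choice of C by <:].
HB.instance Definition _ := [SubChoice_isSubZmodule of C by <:].

Fact corner_one_subproof : e \in eRe.
Proof. by apply/cornerP; rewrite !ee. Qed.

Fact corner_mul_subproof (x y : C) : val x * val y \in eRe.
Proof.
by apply/cornerP; rewrite !mulrA -(mulrA _ _ e) -(cornerP _ (valP x))
  -(cornerP _ (valP y)) !mulrA ee -!mulrA ee.
Qed.

Definition corner_one : C := exist (fun x => x \in eRe) e corner_one_subproof.
Definition corner_mul (x y : C) : C :=
  exist (fun z => z \in eRe) _ (corner_mul_subproof x y).

Fact corner_mulA : associative corner_mul.
Proof. by move=> x y z; apply: val_inj; rewrite /= mulrA. Qed.

Fact corner_mul1 : left_id corner_one corner_mul.
Proof.
move=> x; apply: val_inj => /=.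
by rewrite -(cornerP _ (valP x)) !mulrA ee.
Qed.

Fact corner_mulr1 : right_id corner_one corner_mul.
Proof.
move=> x; apply: val_inj => /=.
by rewrite -(cornerP _ (valP x)) -!mulrA ee.
Qed.

Fact corner_mulDl : left_distributive corner_mul +%R.
Proof. by move=> x y z; apply: val_inj; rewrite /= mulrDl. Qed.

Fact corner_mulDr : right_distributive corner_mul +%R.
Proof. by move=> x y z; apply: val_inj; rewrite /= mulrDr. Qed.

HB.instance Definition _ := GRing.Zmodule_isPzRing.Build C
  corner_mulA corner_mul1 corner_mulr1 corner_mulDl corner_mulDr.

End CornerRing.

Definition topologically_semiperfect (R : topologicalPzRingType) : Prop :=
  exists (Z : choiceType) (e : Z -> R) (ee : forall z, e z * e z = e z),
    [/\ zero_convergent e,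
        forall y z, y <> z -> e y * e z = 0,
        has_sum e 1
      & forall z, local_ring (corner (ee z))].

(* A right R-module is a left module over the converse ring: the right action
   of r on x is [(r : R^c) *: x]. *)
Notation rmodType R := (lmodType R^c).

Section RightModules.
Variable R : pzRingType.

Definition submodule (M : rmodType R) (L : set M) : Prop :=
  additive_subgroup L /\ forall (r : R^c) x, L x -> L (r *: x).

Definition finitely_generated (M : rmodType R) : Prop :=
  exists (n : nat) (g : 'I_n -> M),
    forall x, exists r : 'I_n -> R^c, x = \sum_i r i *: g i.

Definition surjective_hom (M N : rmodType R) (f : {linear M -> N}) : Prop :=
  forall y, exists x, f x = y.

Definition projective (P : rmodType R) : Prop :=
  forall (M N : rmodType R) (g : {linear M -> N}) (f : {linear P -> N}),
    surjective_hom g -> exists h : {linear P -> M}, forall x, g (h x) = f x.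

Definition superfluous (M : rmodType R) (K : set M) : Prop :=
  submodule K /\
  forall L : set M, submodule L ->
    (forall x, exists k l, [/\ K k, L l & x = k + l]) -> L = setT.

Definition kernel (M N : rmodType R) (f : {linear M -> N}) : set M :=
  [set x | f x = 0].

Definition projective_cover (P M : rmodType R) (p : {linear P -> M}) : Prop :=
  [/\ projective P, surjective_hom p & superfluous (kernel p)].

Definition annihilator (M : rmodType R) (x : M) : set R :=
  [set r : R | (r : R^c) *: x = 0].

End RightModules.

Definition discrete_module (R : topologicalPzRingType) (M : rmodType R) : Prop :=
  forall x : M, open_right_ideal (annihilator x).

(* Main.v *)
Require Import Defs.
From HB Require Import structures.
From mathcomp Require Import all_boot all_order all_algebra.
From mathcomp Require Import finmap boolp classical_sets.
From mathcomp Require Import topology tvs summability.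

(** Write x ** r for the right action of r on x.

    Since sum_z e_z = 1 and the annihilators of the elements of M are open,
    each generator g of M satisfies g = sum_(z in J) g ** e_z for some finite
    set J.  Hence M is generated by finitely many elements m, each fixed by
    some e with eRe local.  Taking as few such generators m_1, ..., m_n as
    possible makes the family irredundant: no m_j lies in the span of the
    others (lemma exists_irredundant).

    The cover is the map p from P = e_1 R + ... + e_n R (direct sum) to M which
    sends e_j, placed in the j-th summand, to m_j.  As a direct summand of R^n,
    P is projective.  That eRe is local says that eR is a local module: an
    element of eR which does not generate eR is called nonspanning here, and
    the nonspanning elements form a submodule, because if a + b generates eR
    then so does a or b.  If some v in the kernel of p had an entry v_j with
    v_j c = e_j, then 0 = p (v ** c) would express m_j through the other
    generators, against irredundancy.  So all entries of elements of the
    kernel are nonspanning, and a submodule with this property is superfluous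
    (lemma superfluous_nonspanning): modulo a submodule L with K + L = P, where
    K is the kernel, Gaussian elimination with the pivots e_j - u_j, which
    generate e_j R when u_j is nonspanning, clears the entries one
    after the other. *)

Set Implicit Arguments.
Unset Strict Implicit.
Unset Printing Implicit Defensive.

Import GRing.Theory.

Local Open Scope classical_set_scope.
Local Open Scope ring_scope.

Local Notation "x ** r" := ((r : _^c) *: x) (at level 40, left associativity).

(** * Local idempotents *)

Section LocalIdempotents.
Variable R : pzRingType.

Definition spans (e a : R) : Prop := exists c, a * c = e.

(** The last condition says that eR is not the sum of two proper submodules.
    It amounts to locality of the ring eRe but speaks of elements of R only, so
    that the submodules of eR can be handled without changing rings. *)
Definition local_idempotent (e : R) : Prop :=
  [/\ e * e = e, e <> 0 & forall a b, e * a = a -> e * b = b -> a + b = e ->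
      spans e a \/ spans e b].

(** If a + b = e with a, b in eR, then ae + be = e in eRe, so that ae or be is
    invertible in eRe, and an inverse y of ae yields a (ey) = e. *)
Lemma local_corner_idempotent (e : R) (ee : e * e = e) :
  local_ring (corner ee) -> local_idempotent e.
Proof.
case=> one_neq0 [noninv0 noninvB]; split=> // [e0|a b ea eb abe].
  by apply: one_neq0; apply: val_inj.
have mem_aee x : e * x = x -> x * e \in corner_set e.
  by move=> ex; apply/(cornerP ee); rewrite mulrA ex -mulrA ee.
pose a' : corner ee := exist _ (a * e) (mem_aee a ea).
pose b' : corner ee := exist _ (b * e) (mem_aee b eb).
have inv_spans x (ex : e * x = x) :
    invertible (exist _ (x * e) (mem_aee x ex) : corner ee) -> spans e x.
  by move=> [y [/(congr1 val) /= xy _]]; exists (e * val y); rewrite mulrA.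
have [/inv_spans|ninva] := pselect (invertible a'); first by left.
have [/inv_spans|ninvb] := pselect (invertible b'); first by right.
have : ~ invertible (a' - (0 - b'))
  by exact: noninvB _ _ ninva (noninvB _ _ noninv0 ninvb).
case; suff -> : a' - (0 - b') = 1 by exists 1; rewrite mulr1.
by apply: val_inj; rewrite /= sub0r opprK -mulrDl abe ee.
Qed.

Variables (e : R) (e_local : local_idempotent e).

Lemma not_spans0 : ~ spans e 0.
Proof. by case: e_local => _ e0 _ [c]; rewrite mul0r => /esym. Qed.

Lemma not_spansM a r : ~ spans e a -> ~ spans e (a * r).
Proof. by move=> na [c arc]; apply: na; exists (r * c); rewrite mulrA. Qed.

Lemma not_spansD a b : e * a = a -> e * b = b ->
  ~ spans e a -> ~ spans e b -> ~ spans e (a + b).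
Proof.
case: e_local => _ _ loc ea eb na nb [c]; rewrite mulrDl => abc.
by case: (loc _ _ _ _ abc); rewrite ?mulrA ?ea ?eb // => /not_spansM; apply.
Qed.

Lemma spans_subr a : e * a = a -> ~ spans e a -> spans e (e - a).
Proof.
case: e_local => ee _ loc ea na.
by case: (loc a (e - a)) => //; rewrite ?mulrBr ?ee ?ea // addrC subrK.
Qed.

End LocalIdempotents.

(** * Irredundant generating families *)

Section Generation.
Variables (R : pzRingType) (M : rmodType R).

Definition generates (I : finType) (m : I -> M) : Prop :=
  forall x, exists r : I -> R, x = \sum_i m i ** r i.

Definition irredundant (I : finType) (m : I -> M) : Prop :=
  forall j (r : I -> R), r j = 0 -> m j <> \sum_i m i ** r i.

Lemma generates_spanned (I J : finType) (m : I -> M) (m' : J -> M) :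
  generates m -> (forall i, exists r : J -> R, m i = \sum_j m' j ** r j) ->
  generates m'.
Proof.
move=> gen /choice[c mc] x; have [r ->] := gen x.
exists (fun j => \sum_i c i j * r i).
under eq_bigr do rewrite mc scaler_sumr.
rewrite exchange_big /=; apply: eq_bigr => j _.
by rewrite scaler_suml; apply: eq_bigr => i _; rewrite scalerA.
Qed.

(** A generating family in S of minimal size works: an element which lies in
    the span of the others could be dropped.  The set S carries the condition
    that the generators be fixed by local idempotents, which has to survive
    the choice of a smaller family. *)
Lemma exists_irredundant (S : set M) (I : finType) (m : I -> M) :
  (forall i, S (m i)) -> generates m ->
  exists (n : nat) (m' : 'I_n -> M),
    [/\ forall j, S (m' j), generates m' & irredundant m'].
Proof.
move=> Sm gen.
pose Q n := exists m' : 'I_n -> M, (forall j, S (m' j)) /\ generates m'.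
have exQ : exists n, `[< Q n >].
  exists #|I|; apply/asboolP; exists (m \o enum_val).
  split=> [j|]; first exact: Sm.
  apply: (generates_spanned gen) => i.
  exists (fun j => (j == enum_rank i)%:R).
  rewrite (bigD1 (enum_rank i)) //= eqxx scale1r enum_rankK big1 ?addr0 // => j.
  by move=> /negbTE ->; rewrite scale0r.
case: (ex_minnP exQ) => n /asboolP[m' [Sm' gen']] min_n.
exists n, m'; split=> // j r rj0 mj.
case: n => [|n] in m' Sm' gen' min_n j r rj0 mj *.
  by case: j {rj0 mj}.
suff /asboolP/min_n : Q n by rewrite ltnn.
exists (m' \o lift j); split=> [i|]; first exact: Sm'.
apply: (generates_spanned gen') => i; case: (unliftP j i) => [k|] ->.
  exists (fun i => (i == k)%:R); rewrite (bigD1 k) //= eqxx scale1r.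
  by rewrite big1 ?addr0 // => l /negbTE ->; rewrite scale0r.
exists (r \o lift j).
by rewrite mj (bigD1_ord j) //= rj0 scale0r add0r.
Qed.

End Generation.

(** * Finite direct sums of the modules eR *)

Section IdempotentSum.
Variables (R : pzRingType) (n : nat) (e : 'I_n -> R).

(** The direct sum of the right modules e_j R, as the vectors of R^n fixed by
    the diagonal matrix with entries e_j. *)
Definition idem_rows : {pred 'rV[R^c]_n} :=
  [pred v : 'rV[R^c]_n | [forall j, (e j : R) * (v 0 j : R) == v 0 j]].

Lemma idem_rowsP (v : 'rV[R^c]_n) :
  reflect (forall j, (e j : R) * (v 0 j : R) = v 0 j) (v \in idem_rows).
Proof. by apply: (iffP forallP) => h j; apply/eqP. Qed.

Lemma idem_rows_submod_closed : submod_closed idem_rows.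
Proof.
split=> [|r u v /idem_rowsP hu /idem_rowsP hv]; apply/idem_rowsP => j.
  by rewrite mxE mulr0.
rewrite !mxE mulrDr hv; congr (_ + _).
by rewrite -[in RHS]hu; apply: mulrA.
Qed.

HB.instance Definition _ :=
  GRing.isSubmodClosed.Build R^c 'rV[R^c]_n idem_rows idem_rows_submod_closed.

Definition idem_sum : Type := {v : 'rV[R^c]_n | v \in idem_rows}.
HB.instance Definition _ :=
  [isSub of idem_sum for @sval _ (fun v => v \in idem_rows)].
HB.instance Definition _ := [Choice of idem_sum by <:].
HB.instance Definition _ := [SubChoice_isSubLmodule of idem_sum by <:].

Definition entry (v : idem_sum) (j : 'I_n) : R := val v 0 j.

Lemma entry_inj u v : entry u =1 entry v -> u = v.
Proof. by move=> uv; apply/val_inj/rowP => j; apply: uv. Qed.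

Lemma idem_entry v j : e j * entry v j = entry v j.
Proof. exact: idem_rowsP (valP v) j. Qed.

Lemma entry0 j : entry 0 j = 0.
Proof. by rewrite /entry mxE. Qed.

Lemma entryD u v j : entry (u + v) j = entry u j + entry v j.
Proof. by rewrite /entry mxE. Qed.

Lemma entryN u j : entry (- u) j = - entry u j.
Proof. by rewrite /entry mxE. Qed.

Lemma entryM u r j : entry (u ** r) j = entry u j * r.
Proof. by rewrite /entry mxE. Qed.

Lemma entry_sum (I : Type) (s : seq I) (F : I -> idem_sum) j :
  entry (\sum_(i <- s) F i) j = \sum_(i <- s) entry (F i) j.
Proof.
by apply: (big_morph (entry^~ j)) => [u v|]; rewrite ?entryD ?entry0.
Qed.

Hypothesis ee : forall j, e j * e j = e j.

Fact std_subproof i :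
  \row_j (if j == i then e i else 0 : R^c) \in idem_rows.
Proof.
by apply/idem_rowsP => j; rewrite mxE; case: eqP => [->|_]; rewrite ?ee ?mulr0.
Qed.

Definition std (i : 'I_n) : idem_sum :=
  exist (fun v => v \in idem_rows) _ (std_subproof i).

Lemma entry_std i j : entry (std i) j = if j == i then e i else 0.
Proof. by rewrite /entry mxE. Qed.

Lemma std_expansion v : v = \sum_i std i ** entry v i.
Proof.
apply: entry_inj => j; rewrite entry_sum (bigD1 j) //= big1 => [|i ij].
  by rewrite entryM entry_std eqxx idem_entry addr0.
by rewrite entryM entry_std eq_sym (negbTE ij) mul0r.
Qed.

Section LinearCombination.
Variables (M : rmodType R) (m : 'I_n -> M).

Definition lincomb (v : idem_sum) : M := \sum_j m j ** entry v j.

Fact lincomb_is_linear : linear lincomb.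
Proof.
move=> r u v; rewrite /lincomb scaler_sumr -big_split /=.
by apply: eq_bigr => j _; rewrite entryD entryM scalerDl scalerA.
Qed.

HB.instance Definition _ :=
  GRing.isLinear.Build R^c idem_sum M *:%R lincomb lincomb_is_linear.

End LinearCombination.

(** The elements [std j] and the coordinate maps [entry^~ j] are a dual basis,
    so any choice of preimages of the images of the [std j] determines a lift. *)
Lemma idem_sum_projective : projective (idem_sum : rmodType R).
Proof.
move=> M N g f g_surj.
have /choice[m gm] : forall j, exists x, g x = f (std j).
  by move=> j; apply: g_surj.
exists (lincomb m) => v /=.
rewrite [in RHS](std_expansion v) !linear_sum; apply: eq_bigr => j _.
by rewrite !linearZ /= gm.
Qed.

Hypothesis e_local : forall j, local_idempotent (e j).

Definition nonspanning : set idem_sum :=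
  [set v | forall j, ~ spans (e j) (entry v j)].

Lemma nonspanningD u v : nonspanning u -> nonspanning v -> nonspanning (u + v).
Proof.
by move=> hu hv j; rewrite entryD; apply: not_spansD; rewrite ?idem_entry.
Qed.

Lemma nonspanningM u r : nonspanning u -> nonspanning (u ** r).
Proof. by move=> hu j; rewrite entryM; apply: not_spansM. Qed.

(** Modulo a submodule L with K + L = P, any x is congruent to some nonspanning
    v whose first k entries vanish, by induction on k; for k = n this v is 0.
    For the induction step, [std i] with i = k is congruent to some u of this
    kind, and e_i - u_i generates e_i R, so that a multiple of [std i - u],
    which lies in L, has i-th entry e_i and zeros before it; subtracting
    multiples of it clears the i-th entry without spoiling the earlier ones. *)
Lemma superfluous_nonspanning (K : set (idem_sum : rmodType R)) :
  submodule K -> K `<=` nonspanning -> superfluous K.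
Proof.
move=> subK KN; split=> // L [[L0 LB] LM] KL.
have LN x : L x -> L (- x) by move=> Lx; rewrite -[- x]add0r; apply: LB.
have LD x y : L x -> L y -> L (x + y).
  by move=> Lx Ly; rewrite -[y]opprK; apply: LB => //; apply: LN.
have reduce k : (k <= n)%N -> forall x, exists v,
    [/\ nonspanning v, forall j : 'I_n, (j < k)%N -> entry v j = 0 & L (x - v)].
  elim: k => [_|k IH kn] x.
    have [v [l [/KN Nv Ll ->]]] := KL x.
    by exists v; split; rewrite // addrC addKr.
  pose i := Ordinal kn.
  have [v [Nv v0 Lxv]] := IH (ltnW kn) x.
  have [u [Nu u0 Lu]] := IH (ltnW kn) (std i).
  have [c uc] := spans_subr (e_local i) (idem_entry u i) (Nu i).
  (* The i-th entry of (std i - u) ** c is e_i, so w = std i - (std i - u) ** c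
     agrees with std i modulo L while its i-th entry vanishes as well. *)
  have [w w_entry Lw] : exists2 w,
      forall j, entry w j = (if (j <= i)%N then 0 else entry u j * c) &
      L (std i - w).
    exists (std i - (std i - u) ** c) => [j|]; last by rewrite subKr; apply: LM.
    rewrite entryD entryN entryM entryD entryN entry_std.
    have [->|ji] := eqVneq j i; first by rewrite leqnn uc subrr.
    rewrite !sub0r mulNr opprK leq_eqVlt (negbTE ji : (j == i :> nat) = false) /=.
    by case: ifP => // /u0 ->; rewrite mul0r.
  have v'_entry j : entry (v - std i ** entry v i + w ** entry v i) j =
      if (j <= i)%N then 0 else entry v j + entry w j * entry v i.
    rewrite !entryD entryN !entryM entry_std w_entry.
    have [->|ji] := eqVneq j i.
      by rewrite leqnn idem_entry subrr mul0r addr0.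
    rewrite !mul0r subr0 leq_eqVlt (negbTE ji : (j == i :> nat) = false) /=.
    by case: ifP => // /v0 ->; rewrite mul0r addr0.
  exists (v - std i ** entry v i + w ** entry v i); split.
  - move=> j; rewrite v'_entry; case: ifP => ji; first exact: not_spans0.
    rewrite w_entry ji -mulrA -entryM -entryD.
    exact/nonspanningD/nonspanningM.
  - by move=> j jk; rewrite v'_entry -ltnS jk.
  - suff -> : x - (v - std i ** entry v i + w ** entry v i) =
        (x - v) + (std i - w) ** entry v i by apply: LD => //; apply: LM.
    by rewrite scalerBr -addrA opprD opprD opprK !addrA.
apply/seteqP; split=> // x _.
have [v [_ v0 Lxv]] := reduce n (leqnn n) x.
suff v_eq0 : v = 0 by rewrite v_eq0 subr0 in Lxv.
by apply: entry_inj => j; rewrite v0 ?entry0.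
Qed.

(** If v is in the kernel and v_j c = e_j, then the relation
    0 = sum_i m_i ** (v_i c) has the term m_j ** e_j = m_j at j, and moving the
    other terms to the right contradicts irredundancy.  So the kernel is
    nonspanning, hence superfluous. *)
Lemma lincomb_projective_cover (M : rmodType R) (m : 'I_n -> M) :
    (forall j, m j ** e j = m j) -> generates m -> irredundant m ->
  projective_cover (lincomb m : {linear (idem_sum : rmodType R) -> M}).
Proof.
move=> me gen irr; split; first exact: idem_sum_projective.
  move=> x; have [r ->] := gen x; exists (\sum_i std i ** r i).
  rewrite linear_sum; apply: eq_bigr => j _; rewrite linearZ /=; congr (_ ** _).
  rewrite /lincomb (bigD1 j) //= big1 => [|i ij].
    by rewrite entry_std eqxx me addr0.
  by rewrite entry_std (negbTE ij) scale0r.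
apply: superfluous_nonspanning.
  split; first split=> [|x y]; rewrite /kernel /= ?linear0 //.
    by move=> xK yK; rewrite linearB /= xK yK subrr.
  by move=> r x; rewrite /kernel /= linearZ /= => ->; rewrite scaler0.
move=> v vK j [c vc].
apply: (irr j (fun i => if i == j then 0 else - (entry v i * c))).
  by rewrite eqxx.
have : lincomb m (v ** c) = 0 by rewrite linearZ /= vK scaler0.
rewrite /lincomb (bigD1 j) //= entryM vc me => /eqP; rewrite addr_eq0 => /eqP ->.
rewrite [RHS](bigD1 j) //= eqxx scale0r add0r -sumrN.
by apply: eq_bigr => i /negbTE ->; rewrite entryM scaleNr.
Qed.

End IdempotentSum.

(** * Discrete modules over topologically semiperfect rings *)

(** The finite partial sums s of the e_z satisfy 1 - s --> 0, so 1 - s is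
    eventually in the open annihilators of the finitely many g i. *)
Lemma discrete_finite_sum (R : topologicalPzRingType) (Z : choiceType)
    (e : Z -> R) (M : rmodType R) (I : finType) (g : I -> M) :
    has_sum e 1 -> discrete_module M ->
  exists J : {fset Z}, forall i, g i = \sum_(z : J) g i ** e (val z).
Proof.
move=> sum_e disc; have totally_proper := @totally_filter Z.
have near_i i : \forall J \near totally, annihilator (g i) (1 - partial_sum e J).
  have to0 : 1 - partial_sum e J @[J --> totally] --> (0 : R).
    rewrite -(subrr 1).
    apply: (@cvg_comp _ _ _ (fun J => (1 : R, partial_sum e J)) _ _ _ _ _
      (@sub_continuous R (1, 1))).
    by apply: (@cvg_pair _ _ _ _ (nbhs (1 : R))); [exact: cvg_cst|exact: sum_e].
  have [openA [[A0 _] _]] := disc (g i).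
  exact/to0/open_nbhs_nbhs.
have [J gJ] := filter_ex (filter_forall _ near_i).
exists J => i; have := gJ i; rewrite /annihilator /= scalerBl scale1r => /eqP.
by rewrite subr_eq0 => /eqP {1}->; rewrite /partial_sum scaler_suml.
Qed.

Theorem proposition8p9 (R : topologicalPzRingType)
    (R_lin : right_linear_topology R) (R_complete : complete_separated R)
    (R_semiperfect : topologically_semiperfect R)
    (M : rmodType R) (M_fg : finitely_generated M)
    (M_discrete : discrete_module M) :
  exists (P : rmodType R) (p : {linear P -> M}), projective_cover p.
Proof.
have [Z [e [ee [_ _ sum_e e_loc]]]] := R_semiperfect.
have [k [g gen_g]] := M_fg.
have [J gJ] := discrete_finite_sum g sum_e M_discrete.
pose S : set M := [set x | exists f : R, local_idempotent f /\ x ** f = x].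
pose ge (iz : 'I_k * J) := g iz.1 ** e (val iz.2).
have S_ge iz : S (ge iz).
  exists (e (val iz.2)); split; first exact: local_corner_idempotent (e_loc _).
  by rewrite /ge scalerA; congr (_ ** _); apply: ee.
have gen_ge : generates ge.
  apply: (generates_spanned gen_g) => i; exists (fun iz => (iz.1 == i)%:R).
  rewrite {1}(gJ i) -(pair_bigA _ (fun i' z => ge (i', z) ** (i' == i)%:R)) /=.
  rewrite [RHS](bigD1 i) //= [X in _ + X]big1 ?addr0 => [|i' /negbTE ->].
    by apply: eq_bigr => z _; rewrite eqxx scale1r.
  by apply: big1 => z _; rewrite scale0r.
have [n [m [Sm gen_m irr_m]]] := exists_irredundant S_ge gen_ge.
have /choice[f f_m] := Sm.
have f_loc j : local_idempotent (f j) by have [] := f_m j.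
have ff j : f j * f j = f j by have [] := f_loc j.
have mf j : m j ** f j = m j by have [] := f_m j.
exists (idem_sum f), (lincomb m).
exact: lincomb_projective_cover.
Qed.
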